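(* For all sufficiently large $n$, the set of $G\in F(n,4,15)$ maximizing $P(G)$ over $F(n,4,15)$ equals the set of $G\in D(n)$ maximizing $P(G)$ over $D(n)$.
   Context: A multigraph is $(V,w)$ with $w:\binom V2\to\mathbb{N}$; $\mu(G)=\max w$, $P(G)=\prod_{xy}w(xy)$. An $(s,q)$-graph is a multigraph in which every $s$ vertices span total multiplicity at most $q$; $F(n,s,q)$ is the set of $(s,q)$-graphs on vertex set $[n]$. $D(n)=\{G\in F(n,4,15):\mu(G)\le 3\}\cap F(n,3,8)$. *)

(* Defs.v *)
From mathcomp Require Import all_boot.

Set Implicit Arguments.
Unset Strict Implicit.
Unset Printing Implicit Defensive.

Definition pair_of (T : finType) : Type := {e : {set T} | #|e| == 2}.

(* Multiplicities are attached to unordered pairs of distinct vertices, so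
   Leibniz equality of multigraphs is equality of their weight functions. *)
Definition multigraph (T : finType) : Type := {ffun pair_of T -> nat}.

Definition max_mult (T : finType) (w : multigraph T) : nat :=
  \max_(e : pair_of T) w e.

Definition prod_mult (T : finType) (w : multigraph T) : nat :=
  \prod_(e : pair_of T) w e.

Definition span_mult (T : finType) (w : multigraph T) (X : {set T}) : nat :=
  \sum_(e : pair_of T | val e \subset X) w e.

Definition sq_graph (T : finType) (s q : nat) (w : multigraph T) : bool :=
  [forall X : {set T}, (#|X| == s) ==> (span_mult w X <= q)].

(* The vertex set [n] is the type 'I_n = {0, ..., n-1}. *)
Definition F (n s q : nat) : {pred multigraph 'I_n} :=
  [pred w | sq_graph s q w].
Arguments F : clear implicits.

Definition D (n : nat) : {pred multigraph 'I_n} :=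
  [pred w | [&& w \in F n 4 15, max_mult w <= 3 & w \in F n 3 8]].
Arguments D : clear implicits.

Definition maximizes_prod (n : nat) (A : {pred multigraph 'I_n})
    (w : multigraph 'I_n) : Prop :=
  w \in A /\ forall w' : multigraph 'I_n, w' \in A -> prod_mult w' <= prod_mult w.

(* Main.v *)
Require Import Defs.
From mathcomp Require Import all_boot zify.

(* Suppose a maximizer M of P over F(n,4,15) is not in D(n). Then it has a triple
   of weight at least 9, or an edge of multiplicity at least 4, and in both cases
   some set X of k = 2 or 3 vertices sends to the rest of the graph a total product
   of order at most 96^(kn/6): deleting X loses little. If a maximizer on n - k
   vertices lies in D, then so does the graph obtained by cloning its vertex of
   largest degree k times, and comparison with P(M) shows that its P is small; if
   it does not lie in D, repeat. Hence P(M)^12 is at most 96^(n^2) up to a factor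
   exponential in n. But splitting the vertices in parts of sizes n/3 and 2n/3,
   with multiplicities 1 and 2 inside the parts and 3 across, gives P^12 of order
   6^(8n^2/3), and 96^3 < 6^8. *)

Set Implicit Arguments.
Unset Strict Implicit.
Unset Printing Implicit Defensive.

(** * Multigraphs read as symmetric weights on ordered pairs of vertices *)

(* The value 1 on the diagonal is neutral for products, and makes the pullback of
   [wt G] along a non-injective map clone vertices, joining clones by edges of
   multiplicity 1. *)
Definition wt (T : finType) (G : multigraph T) (x y : T) : nat :=
  oapp G 1 (insub [set x; y] : option {e : {set T} | #|e| == 2}).

Lemma wtC (T : finType) (G : multigraph T) (x y : T) : wt G x y = wt G y x.
Proof. by rewrite /wt setUC. Qed.

Lemma wtxx (T : finType) (G : multigraph T) (x : T) : wt G x x = 1.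
Proof. by rewrite /wt insubN // setUid cards1. Qed.

Lemma wt_val (T : finType) (G : multigraph T) (x y : T) (e : pair_of T) :
  val e = [set x; y] -> wt G x y = G e.
Proof. by rewrite /wt => <-; rewrite valK. Qed.

Lemma pair_ofE (T : finType) (e : pair_of T) :
  exists x y, x != y /\ val e = [set x; y].
Proof.
exact/cards2P/(valP e).
Qed.

Lemma pair_of_exists (T : finType) (x y : T) :
  x != y -> exists e : pair_of T, val e = [set x; y].
Proof.
move=> xy; have c2 : #|[set x; y]| == 2 by rewrite cards2 xy.
by exists (exist (fun e : {set T} => #|e| == 2) _ c2).
Qed.

(** Every two-element set [{a, b}] arises from exactly the two ordered pairs [(a, b)] and [(b, a)].
    An arbitrary commutative monoid lets one proof serve both products and sums. *)
Lemma big_ordered_pairs (R : Type) (idx : R) (op : Monoid.com_law idx)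
    (T : finType) (P : pred {set T}) (h : {set T} -> R) :
  \big[op/idx]_(p : T * T | (p.1 != p.2) && P [set p.1; p.2]) h [set p.1; p.2] =
  \big[op/idx]_(e : pair_of T | P (val e)) op (h (val e)) (h (val e)).
Proof.
rewrite (partition_big (fun p => [set p.1; p.2]) (fun S => (#|S| == 2) && P S)) /=;
  last by move=> p /andP[p12 ->]; rewrite cards2 p12.
have -> : \big[op/idx]_(e : pair_of T | P (val e)) op (h (val e)) (h (val e)) =
  \big[op/idx]_(S : {set T} | (#|S| == 2) && P S) op (h S) (h S).
  rewrite (reindex_omap (val : pair_of T -> {set T}) insub) /=; last first.
    by move=> S /andP[c2 _]; case: insubP => [e _ <-|] //=; rewrite c2.
  by apply: eq_bigl => e; rewrite valK eqxx (valP e) andbT.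
apply: eq_bigr => S /andP[/cards2P[a [b [ab ->]]] PS].
transitivity (\big[op/idx]_(p <- [:: (a, b); (b, a)]) h [set p.1; p.2]).
  rewrite big_uniq /=; last by rewrite inE xpair_eqE negb_and ab.
  apply: eq_bigl => -[x y] /=; rewrite !inE !xpair_eqE.
  apply/idP/idP.
    case/andP=> /andP[xy _] /eqP E.
    have: x \in [set a; b] by rewrite -E !inE eqxx.
    have: y \in [set a; b] by rewrite -E !inE eqxx orbT.
    by rewrite !inE => /pred2P[] ? /pred2P[] ?; subst;
      rewrite ?eqxx ?orbT // in xy *.
  case/orP=> /andP[/eqP-> /eqP->]; first by rewrite ab PS eqxx.
  by rewrite eq_sym ab setUC PS eqxx.
by rewrite !big_cons big_nil /= Monoid.mulm1 (setUC [set b]).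
Qed.

Lemma prod_mult_sqr (T : finType) (G : multigraph T) :
  prod_mult G ^ 2 = \prod_x \prod_y wt G x y.
Proof.
rewrite pair_bigA /= (bigID (fun p : T * T => p.1 != p.2)) /=.
rewrite [X in _ * X]big1 ?muln1; last by case=> x y /= /negPn/eqP->; rewrite wtxx.
pose h S := oapp G 1 (insub S : option {e : {set T} | #|e| == 2}).
have -> : \prod_(p : T * T | p.1 != p.2) wt G p.1 p.2 =
  \prod_(p : T * T | (p.1 != p.2) && xpredT [set p.1; p.2]) h [set p.1; p.2].
  by apply: eq_bigl => p; rewrite andbT.
rewrite (@big_ordered_pairs nat 1 muln T xpredT h) -mulnn -big_split /=.
by apply: eq_bigr => e _; rewrite /h valK.
Qed.

Lemma span_mult_double (T : finType) (G : multigraph T) (s : seq T) :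
  uniq s ->
  (span_mult G [set x in s]).*2 = \sum_(x <- s) \sum_(y <- s | x != y) wt G x y.
Proof.
move=> us; pose h S := oapp G 1 (insub S : option {e : {set T} | #|e| == 2}).
have := @big_ordered_pairs _ _ addn T (fun S => S \subset [set x in s]) h.
have -> : \sum_(e : pair_of T | val e \subset [set x in s]) (h (val e) + h (val e)) =
  (span_mult G [set x in s]).*2.
  by rewrite -addnn /span_mult -big_split; apply: eq_bigr => e _; rewrite /h valK.
move=> <-; rewrite big_uniq //.
under [RHS]eq_bigr => x _ do rewrite -big_filter big_uniq ?filter_uniq //.
rewrite pair_big_dep /=; apply: eq_bigl => -[x y] /=.
by rewrite subUset !sub1set !inE mem_filter; case: (x == y); rewrite ?andbF.
Qed.

Lemma sq_graphP (T : finType) (s q : nat) (G : multigraph T) :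
  reflect (forall r : seq T, uniq r -> size r = s ->
             \sum_(x <- r) \sum_(y <- r | x != y) wt G x y <= q.*2)
          (sq_graph s q G).
Proof.
apply: (iffP forallP) => [H r ur sr|H X].
  have := H [set x in r]; rewrite cardsE (card_uniqP ur) sr eqxx /=.
  by rewrite -span_mult_double // leq_double.
apply/implyP=> /eqP cX; have := H (enum X) (enum_uniq _).
rewrite -cardE => /(_ cX); rewrite -span_mult_double ?enum_uniq // leq_double.
by rewrite set_enum.
Qed.

Definition quad_bounded (T : eqType) (w : T -> T -> nat) : Prop :=
  forall x y z t, uniq [:: x; y; z; t] ->
    w x y + w x z + w x t + w y z + w y t + w z t <= 15.

Lemma sq_graph_4_15P (T : finType) (G : multigraph T) :
  sq_graph 4 15 G <-> quad_bounded (wt G).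
Proof.
have E x y z t : uniq [:: x; y; z; t] ->
  \sum_(a <- [:: x; y; z; t]) \sum_(b <- [:: x; y; z; t] | a != b) wt G a b =
  (wt G x y + wt G x z + wt G x t + wt G y z + wt G y t + wt G z t).*2.
  rewrite /= !inE !negb_or andbT => /and3P[/and3P[xy xz xt] /andP[yz yt] zt].
  rewrite !big_cons !big_nil !eqxx !(eq_sym z) !(eq_sym t) !(eq_sym y x).
  rewrite xy xz xt yz yt zt /= !(wtC G z) !(wtC G t) !(wtC G y x); lia.
split=> [/sq_graphP H x y z t u|H].
  by rewrite -leq_double -E //; apply: H.
apply/sq_graphP=> -[|x [|y [|z [|t [|? ?]]]]] // u _.
by rewrite E // leq_double; apply: H.
Qed.

Lemma sq_graph_3_8P (T : finType) (G : multigraph T) :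
  sq_graph 3 8 G <->
  (forall x y z, uniq [:: x; y; z] -> wt G x y + wt G x z + wt G y z <= 8).
Proof.
have E x y z : uniq [:: x; y; z] ->
  \sum_(a <- [:: x; y; z]) \sum_(b <- [:: x; y; z] | a != b) wt G a b =
  (wt G x y + wt G x z + wt G y z).*2.
  rewrite /= !inE !negb_or andbT => /andP[/andP[xy xz] yz].
  rewrite !big_cons !big_nil !eqxx !(eq_sym z) !(eq_sym y x).
  rewrite xy xz yz /= !(wtC G z) !(wtC G y x); lia.
split=> [/sq_graphP H x y z u|H].
  by rewrite -leq_double -E //; apply: H.
apply/sq_graphP=> -[|x [|y [|z [|? ?]]]] // u _.
by rewrite E // leq_double; apply: H.
Qed.

Lemma max_mult_leP (T : finType) (k : nat) (G : multigraph T) :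
  max_mult G <= k <-> (forall x y, x != y -> wt G x y <= k).
Proof.
split=> [/bigmax_leqP H x y /pair_of_exists[e E]|H].
  by rewrite (wt_val _ E); apply: H.
apply/bigmax_leqP=> e _; have [x [y [xy E]]] := pair_ofE e.
by rewrite -(wt_val _ E); apply: H.
Qed.

(** * Multigraphs built from weights, and basic facts about maximizers *)

(** The maxima spare a choice of endpoint order: only [(x, y)] and [(y, x)] contribute, with equal
    values when [w] is symmetric. *)
Definition graph_of (T : finType) (w : T -> T -> nat) : multigraph T :=
  [ffun e : pair_of T => \max_(x in val e) \max_(y in val e | x != y) w x y].

Lemma wt_graph_of (T : finType) (w : T -> T -> nat) :
  (forall x y, w x y = w y x) -> (forall x, w x x = 1) ->
  wt (graph_of w) =2 w.
Proof.
move=> wC wxx x y; have [->|xy] := eqVneq x y; first by rewrite wtxx wxx.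
have [e E] := pair_of_exists xy; rewrite (wt_val _ E) ffunE E.
have B a b : a != b ->
  \max_(z in [set a; b] | a != z) w a z = w a b.
  move=> ab; rewrite (big_pred1 b) // => z; rewrite !inE.
  by have [->|] := eqVneq z a; rewrite ?eqxx ?(negPf ab) //= eq_sym andbT.
rewrite big_setU1 ?inE //= big_set1 B // setUC B 1?eq_sym // (wC y) maxnn //.
Qed.

Definition is_weight (T : eqType) (w : T -> T -> nat) : Prop :=
  [/\ forall x y, w x y = w y x, forall x, w x x = 1 & quad_bounded w].

Lemma is_weight_inj (S T : eqType) (f : S -> T) (w : T -> T -> nat) :
  injective f -> is_weight w -> is_weight (fun x y => w (f x) (f y)).
Proof.
move=> fI [wC wxx w4]; split=> // x y z t u; apply: w4.
by rewrite -(map_inj_uniq fI) in u.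
Qed.

Definition square_prod (T : finType) (w : T -> T -> nat) : nat :=
  \prod_x \prod_y w x y.

Lemma wt_is_weight (n : nat) (G : multigraph 'I_n) :
  G \in F n 4 15 -> is_weight (wt G).
Proof.
by move=> /sq_graph_4_15P G4; split=> // [x y|x]; rewrite (wtC, wtxx).
Qed.

Lemma square_prod_graph_of (T : finType) (w : T -> T -> nat) :
  is_weight w -> prod_mult (graph_of w) ^ 2 = square_prod w.
Proof.
case=> wC wxx _; rewrite prod_mult_sqr.
by apply: eq_bigr => x _; apply: eq_bigr => y _; rewrite wt_graph_of.
Qed.

Lemma graph_of_in_F (n : nat) (w : 'I_n -> 'I_n -> nat) :
  is_weight w -> graph_of w \in F n 4 15.
Proof.
case=> wC wxx w4; apply/sq_graph_4_15P => x y z t u.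
by rewrite !wt_graph_of //; apply: w4.
Qed.

Lemma maximizer_square_prod (n : nat) (M : multigraph 'I_n)
    (w : 'I_n -> 'I_n -> nat) :
  maximizes_prod (F n 4 15) M -> is_weight w ->
  square_prod w <= square_prod (wt M).
Proof.
move=> [_ Mmax] ww; rewrite -square_prod_graph_of // -[leqRHS]prod_mult_sqr.
by rewrite leq_exp2r //; apply/Mmax/graph_of_in_F.
Qed.

(** The constant weight 1 is admissible and has product 1, so a maximizer cannot have product 0. *)
Lemma maximizer_wt_gt0 (n : nat) (M : multigraph 'I_n) (x y : 'I_n) :
  maximizes_prod (F n 4 15) M -> 0 < wt M x y.
Proof.
move=> Mmax; have: is_weight (fun _ _ : 'I_n => 1) by split.
move=> /(maximizer_square_prod Mmax); rewrite {1}/square_prod.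
rewrite big1 => [|i _]; last by rewrite big1.
have [w0|//] := posnP (wt M x y).
by rewrite /square_prod (bigD1 x) //= (bigD1 y) //= w0.
Qed.

Lemma card_ge4_others (T : finType) (x y : T) :
  4 <= #|T| -> x != y -> exists z t, uniq [:: x; y; z; t].
Proof.
move=> T4 xy; have: 1 < #|~: [set x; y]|.
  by have := cardsC [set x; y]; rewrite cards2 xy; lia.
move=> /card_gt1P[z [t [zX tX zt]]]; exists z, t.
move: zX tX; rewrite /= !inE !negb_or xy zt !(eq_sym x) !(eq_sym y).
by move=> /andP[-> ->] /andP[-> ->].
Qed.

Lemma weight_le15 (T : finType) (w : T -> T -> nat) (x y : T) :
  4 <= #|T| -> is_weight w -> w x y <= 15.
Proof.
move=> T4 [wC wxx w4]; have [->|xy] := eqVneq x y; first by rewrite wxx.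
by have [z [t /w4]] := card_ge4_others T4 xy; lia.
Qed.

(** For [4 <= n] every edge lies in a quadruple, hence has multiplicity at most 15. Functions into
    ['I_16] thus cover all candidates and form a finite type. *)
Lemma maximizer_exists (n : nat) :
  4 <= n -> exists M, maximizes_prod (F n 4 15) M.
Proof.
move=> n4.
pose toG (H : {ffun pair_of 'I_n -> 'I_16}) : multigraph 'I_n :=
  [ffun e : pair_of 'I_n => nat_of_ord (H e)].
have lt16 (G : multigraph 'I_n) e : G \in F n 4 15 -> G e < 16.
  have [x [y [_ E]]] := pair_ofE e.
  move=> /wt_is_weight Gw; rewrite -(wt_val G E) ltnS weight_le15 //.
  by rewrite card_ord.
have toGK G : G \in F n 4 15 -> toG [ffun e => inord (G e)] = G.
  by move=> GF; apply/ffunP => e; rewrite !ffunE inordK ?lt16.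
have one : graph_of (fun _ _ : 'I_n => 1) \in F n 4 15.
  by apply: graph_of_in_F; split.
pose H0 : {ffun pair_of 'I_n -> 'I_16} :=
  [ffun e => inord (graph_of (fun _ _ : 'I_n => 1) e)].
have H0F : toG H0 \in F n 4 15 by rewrite toGK.
exists (toG [arg max_(H > H0 | toG H \in F n 4 15) prod_mult (toG H)]).
case: arg_maxnP => // H HF Hmax; split=> // G GF.
by rewrite -(toGK G GF); apply: Hmax; rewrite toGK.
Qed.

(** * Cuts of small product around a heavy triple or a heavy edge *)

Definition cut_prod (T : finType) (w : T -> T -> nat) (X : {set T}) : nat :=
  \prod_(v in ~: X) \prod_(x in X) w x v.

Lemma square_prod_cut (T : finType) (w : T -> T -> nat) (X : {set T}) :
  is_weight w ->
  square_prod w = (\prod_(x in ~: X) \prod_(y in ~: X) w x y)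
    * (\prod_(x in X) \prod_(y in X) w x y) * cut_prod w X ^ 2.
Proof.
case=> wC _ _.
have sp (f : T -> nat) :
  \prod_x f x = (\prod_(x in ~: X) f x) * \prod_(x in X) f x.
  rewrite (bigID (mem X)) mulnC /=; congr (_ * _).
  by apply: eq_bigl => x; rewrite !inE.
rewrite /square_prod sp; under eq_bigr => x _ do rewrite sp.
rewrite big_split /=.
under [X in _ * _ * X]eq_bigr => x _ do rewrite sp.
rewrite big_split /= [X in _ * (X * _)]exchange_big /=.
have -> : \prod_(x in ~: X) \prod_(y in X) w x y = cut_prod w X.
  by apply: eq_bigr => x _; apply: eq_bigr => y _; rewrite wC.
rewrite -/(cut_prod w X) -mulnn; lia.
Qed.

Lemma cut_prod2 (T : finType) (w : T -> T -> nat) (x y : T) :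
  x != y ->
  cut_prod w [set x; y] = \prod_(v in ~: [set x; y]) (w x v * w y v).
Proof.
by move=> xy; apply: eq_bigr => v _; rewrite big_setU1 ?inE // big_set1.
Qed.

Lemma prod_le_exp (T : finType) (A : {set T}) (f : T -> nat) (c : nat) :
  0 < c -> {in A, forall u, f u <= c} -> \prod_(u in A) f u <= c ^ #|T|.
Proof.
move=> c0 fc; apply: (leq_trans (leq_prod fc)).
by rewrite prod_nat_const leq_pexp2l // max_card.
Qed.

(** At most one factor exceeds [c], and [K] pays for it. *)
Lemma prod_one_exception (T : finType) (A : {set T}) (f : T -> nat) (c K m : nat) :
  0 < c -> 0 < K -> {in A, forall u, f u <= K} ->
  {in A &, forall u v, u != v -> (f u <= c) || (f v <= c)} -> #|A| <= m ->
  \prod_(u in A) f u <= K * c ^ m.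
Proof.
move=> c0 K0 fK fc Am.
have [/existsP[u /andP[uA fu]]|] := boolP [exists u, (u \in A) && (c < f u)].
  rewrite (big_setD1 u) //=; apply: leq_mul; first exact: fK.
  have: {in A :\ u, forall v, f v <= c}.
    move=> v /setD1P[vu vA]; have := fc u v uA vA.
    by rewrite eq_sym vu leqNgt fu; apply.
  move=> /leq_prod /leq_trans -> //; rewrite prod_nat_const leq_pexp2l //.
  exact: leq_trans (subset_leq_card (subD1set _ _)) Am.
rewrite negb_exists => /forallP fle.
have: {in A, forall v, f v <= c}.
  by move=> v vA; have := fle v; rewrite vA -leqNgt.
move=> /leq_prod /leq_trans -> //; rewrite prod_nat_const.
by apply: leq_trans (leq_pmull _ K0); rewrite leq_pexp2l.
Qed.

(** Any other vertex sends to the triple a total of at most 15 - 9 = 6, so a product of at most 2 *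
    2 * 2 = 8. *)
Lemma heavy_triangle_cut (T : finType) (w : T -> T -> nat) (x y z : T) :
  is_weight w -> (forall u v, 0 < w u v) -> uniq [:: x; y; z] ->
  9 <= w x y + w x z + w y z -> cut_prod w [set x; y; z] <= 8 ^ #|T|.
Proof.
move=> [wC wxx w4] w0 u9 xyz; apply: prod_le_exp => // v.
rewrite !inE !negb_or => /andP[/andP[vx vy] vz].
move: (u9); rewrite /= !inE negb_or andbT => /andP[/andP[xy xz] yz].
rewrite -setUA big_setU1 ?inE ?negb_or ?xy // big_setU1 ?inE // big_set1.
have: uniq [:: x; y; z; v].
  by rewrite /= !inE !negb_or xy xz yz !(eq_sym _ v) vx vy vz.
move=> /w4; move: (w0 x v) (w0 y v) (w0 z v).
move: (w x v) (w y v) (w z v) => a b c a0 b0 c0 abc.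
have s6 : a + b + c <= 6 by lia.
(* The other two multiplicities are at least 1, which leaves finitely many cases. *)
have [a4 b4 c4] : [/\ a < 5, b < 5 & c < 5] by split; lia.
by move: a b c a4 b4 c4 s6 {a0 b0 c0 abc} =>
  [|[|[|[|[|a]]]]] [|[|[|[|[|b]]]]] [|[|[|[|[|c]]]]].
Qed.

Lemma leq_exp2rW (m n e : nat) : m <= n -> m ^ e <= n ^ e.
Proof. by case: e => // e; rewrite leq_exp2r. Qed.

Lemma leq_mul_half (a b c : nat) : a + b <= c.*2 -> a * b <= c ^ 2.
Proof.
move=> abc; rewrite -(@leq_pmul2l 4) //; have [H _] := nat_AGM2 a b.
by apply: leq_trans H _; rewrite -[4]/(2 ^ 2) -expnMn mul2n leq_exp2rW.
Qed.

(** The extreme case is [n = 3 * a], with equality since 6 * 4 ^ 2 = 96. *)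
Lemma cube_6_4_le96 (a n : nat) : 3 * a <= n -> (6 ^ a * 4 ^ (n - a)) ^ 3 <= 96 ^ n.
Proof.
move=> an; have [d ->] : exists d, n = 3 * a + d by exists (n - 3 * a); lia.
have -> : 3 * a + d - a = 2 * a + d by lia.
rewrite -[96]/(6 * 16) expnMn -!expnM expnMn.
have -> : 4 ^ ((2 * a + d) * 3) = 16 ^ (3 * a) * 4 ^ d * 16 ^ d.
  by rewrite -[16]/(4 ^ 2) -!expnM -!expnD; congr expn; lia.
have := leq_exp2rW d (isT : 4 <= 6).
rewrite (expnD 6) (expnD 16) (mulnC a).
move: (6 ^ (3 * a)) (16 ^ (3 * a)) (4 ^ d) (6 ^ d) (16 ^ d) => p q r s t rs.
by rewrite -!mulnA leq_mul2l [X in _ <= X]mulnCA leq_mul2l leq_mul2r rs !orbT.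
Qed.

Lemma cube_9_le96 (a n : nat) : n < 3 * a -> (9 ^ (n - a)) ^ 3 <= 96 ^ n.
Proof.
move=> an; rewrite -expnM; apply: (@leq_trans (9 ^ (2 * n))).
  by rewrite leq_pexp2l //; lia.
by rewrite expnM leq_exp2rW.
Qed.

(* Write S u = w x u + w y u. Two vertices u, v outside {x, y} satisfy
   S u + S v + w u v <= 11. If some S u >= 6, then S v <= 4 for all other v, and
   X = {x, y} works. Otherwise all S u <= 5 and the set A where S u = 5 spans only
   edges of multiplicity 1: if A has at most a third of the vertices then
   X = {x, y} works, else any two vertices of A do. *)
Lemma heavy_edge_cut (T : finType) (w : T -> T -> nat) (x y : T) :
  4 <= #|T| -> is_weight w -> (forall u v, 0 < w u v) -> x != y -> 4 <= w x y ->
  exists X : {set T}, #|X| = 2 /\ cut_prod w X ^ 3 <= 225 ^ 3 * 96 ^ #|T|.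
Proof.
move=> T4 ww w0 xy wxy; have [wC wxx w4] := ww.
pose Y := ~: [set x; y]; pose S u := w x u + w y u.
have le15 u v : w u v <= 15 by apply: weight_le15.
have K225 a b c : w a c * w b c <= 225 by have := leq_mul (le15 a c) (le15 b c).
have SS u v : u \in Y -> v \in Y -> u != v -> S u + S v + w u v <= 11.
  rewrite !inE !negb_or => /andP[ux uy] /andP[vx vy] uv.
  have: uniq [:: x; y; u; v].
    by rewrite /= !inE !negb_or xy uv !(eq_sym x) !(eq_sym y) ux uy vx vy.
  by move=> /w4; rewrite /S; lia.
have [/existsP[u /andP[uY Su]]|] := boolP [exists u, (u \in Y) && (6 <= S u)].
  exists [set x; y]; rewrite cards2 xy; split=> //.
  apply: (@leq_trans ((225 * 4 ^ #|T|) ^ 3)); last first.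
    by rewrite expnMn leq_mul2l expnAC leq_exp2rW ?orbT.
  rewrite leq_exp2r // cut_prod2 //.
  apply: prod_one_exception => //; [|exact: max_card] => a b aY bY ab.
  have small v : v \in Y -> v != u -> w x v * w y v <= 4.
    (* Since [w u v] is positive, [S v] is at most 11 - 6 - 1 = 4, and the product is at most 2 ^
       2. *)
    move=> vY vu; have := SS u v uY vY; rewrite eq_sym vu => /(_ isT).
    have := w0 u v => ? ?; apply: (@leq_mul_half _ _ 2).
    by rewrite -/(S v); lia.
  have [au|au] := eqVneq a u; last by rewrite small.
  by rewrite (small b) ?orbT // -au eq_sym.
rewrite negb_exists => /forallP S5.
have {}S5 u : u \in Y -> S u <= 5.
  by move=> uY; have := S5 u; rewrite uY -ltnNge.
pose A := [set u in Y | S u == 5].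
have AY : A \subset Y by apply/subsetP=> u; rewrite inE => /andP[].
have [A3|A3] := leqP (3 * #|A|) #|T|.
  exists [set x; y]; rewrite cards2 xy; split=> //.
  have E : cut_prod w [set x; y] <= 6 ^ #|A| * 4 ^ (#|T| - #|A|).
    rewrite cut_prod2 // -/Y (big_setID A) /= (setIidPr AY); apply: leq_mul.
      rewrite -prod_nat_const; apply: leq_prod => u; rewrite inE.
      move=> /andP[_ /eqP]; rewrite /S; move: (w x u) (w y u) => a b ab5.
      have a6 : a < 6 by lia.
      by move: a b a6 ab5 => [|[|[|[|[|[|a]]]]]] // b _ ab5; lia.
    apply: (@leq_trans (\prod_(u in Y :\: A) 4)); last first.
      rewrite prod_nat_const leq_pexp2l // cardsD (setIidPr AY).
      by rewrite leq_sub2r // max_card.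
    apply: leq_prod => u /setDP[uY nA]; have := S5 u uY.
    have: S u != 5 by apply: contra nA => Su; rewrite inE uY.
    by move=> ? ?; apply: (@leq_mul_half _ _ 2); rewrite -/(S u); lia.
  apply: (@leq_trans ((6 ^ #|A| * 4 ^ (#|T| - #|A|)) ^ 3)).
    by rewrite leq_exp2r.
  apply: leq_trans (cube_6_4_le96 A3) (leq_pmull _ _).
  by rewrite expn_gt0.
have /card_gt1P[u [v [uA vA uv]]] : 1 < #|A| by lia.
have A1 z t : z \in A -> t \in A -> z != t -> w z t = 1.
  move=> zA tA zt; have := w0 z t.
  have mA r : r \in A -> r \in Y /\ S r = 5 by rewrite inE => /andP[-> /eqP].
  have [[zY Sz] [tY St]] := (mA z zA, mA t tA).
  by have := SS z t zY tY zt; lia.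
exists [set u; v]; rewrite cards2 uv; split=> //.
have E : cut_prod w [set u; v] <= 225 * 9 ^ (#|T| - #|A|).
  rewrite cut_prod2 // (bigID (mem A)) /= big1 ?mul1n; last first.
    move=> z /andP[]; rewrite !inE negb_or => /andP[zu zv] zA.
    by rewrite !A1 // ?inE // eq_sym.
  rewrite (eq_bigl (mem (~: A :\: [set u; v]))); last first.
    by move=> z; rewrite !inE.
  apply: prod_one_exception => //; last first.
    by rewrite -(cardsC A) addKn subset_leq_card // subsetDl.
  move=> z t /setDP[_ zX] /setDP[_ tX] zt.
  have: uniq [:: u; v; z; t].
    move: zX tX; rewrite /= !inE !negb_or uv zt !(eq_sym u) !(eq_sym v).
    by move=> /andP[-> ->] /andP[-> ->].
  (* Both [w u v] and [w z t] are at least 1, so the sums from [u] and [v] to [z] and to [t] total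
     at most 13. One of them is at most 6, with product at most 3 ^ 2. *)
  move=> /w4; have := w0 u v; have := w0 z t.
  have [S6|S7] := leqP (w u z + w v z) 6.
    by rewrite (@leq_mul_half _ _ 3 S6).
  move=> *; rewrite [X in _ || X](@leq_mul_half _ _ 3) ?orbT //; lia.
apply: leq_trans (leq_exp2rW 3 E) _.
by rewrite expnMn leq_mul2l cube_9_le96 ?orbT.
Qed.

Lemma notin_D_heavy (n : nat) (G : multigraph 'I_n) :
  G \in F n 4 15 -> G \notin D n ->
  (exists x y, x != y /\ 4 <= wt G x y) \/
  (exists x y z, uniq [:: x; y; z] /\ 9 <= wt G x y + wt G x z + wt G y z).
Proof.
rewrite inE => GF; rewrite !inE GF /= negb_and => /orP[] H; [left|right].
  have [/'exists_existsP[x [y /andP[xy xy4]]]|] :=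
    boolP [exists x, exists y, (x != y) && (4 <= wt G x y)]; first by exists x, y.
  rewrite negb_exists => /forallP E; case/negP: H; apply/max_mult_leP => x y xy.
  by have := E x; rewrite negb_exists => /forallP/(_ y); rewrite xy -ltnNge.
pose P x y z := uniq [:: x; y; z] && (9 <= wt G x y + wt G x z + wt G y z).
have [/existsP[x /existsP[y /existsP[z /andP[u s9]]]]|] :=
  boolP [exists x, exists y, exists z, P x y z]; first by exists x, y, z.
rewrite negb_exists => /forallP E; case/negP: H; apply/sq_graph_3_8P => x y z u.
have := E x; rewrite negb_exists => /forallP/(_ y); rewrite negb_exists.
by move=> /forallP/(_ z); rewrite /P u /= -ltnNge.
Qed.

(** The sixth power makes both cases uniform in [#|X|]: a heavy edge gives the square of a bound in
    96 ^ n, and a heavy triple gives 8 ^ (6n) = 64 ^ (3n). *)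
Lemma small_cut (n : nat) (M : multigraph 'I_n) :
  4 <= n -> maximizes_prod (F n 4 15) M -> M \notin D n ->
  exists X : {set 'I_n}, 2 <= #|X| <= 3 /\
    cut_prod (wt M) X ^ 6 <= 225 ^ 6 * 96 ^ (#|X| * n).
Proof.
move=> n4 Mmax MD; have MF := Mmax.1; have Mw := wt_is_weight MF.
have M0 x y : 0 < wt M x y by apply: maximizer_wt_gt0.
have [[x [y [xy w4]]]|[x [y [z [u w9]]]]] := notin_D_heavy MF MD.
  have [|X [X2]] := heavy_edge_cut _ Mw M0 xy w4; first by rewrite card_ord.
  rewrite card_ord => E; exists X; rewrite X2; split=> //.
  by have := leq_exp2rW 2 E; rewrite expnMn -!expnM (mulnC n).
have E := heavy_triangle_cut Mw M0 u w9; rewrite card_ord in E.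
have X3 : #|[set x; y; z]| = 3.
  rewrite -[RHS]/(size [:: x; y; z]) -(card_uniqP u).
  by apply: eq_card => v; rewrite !inE orbA.
exists [set x; y; z]; rewrite X3; split=> //.
apply: leq_trans (leq_exp2rW 6 E) (leq_trans _ (leq_pmull _ _)); last first.
  by rewrite expn_gt0.
have -> : (8 ^ n) ^ 6 = (64 ^ 3) ^ n by rewrite -[64]/(8 ^ 2) -!expnM; congr expn; lia.
by rewrite expnM; do 2!apply: leq_exp2rW.
Qed.

Lemma maximizer_step (n : nat) (M : multigraph 'I_n) :
  4 <= n -> maximizes_prod (F n 4 15) M -> M \notin D n ->
  exists2 k, 2 <= k <= 3 &
    forall M', maximizes_prod (F (n - k) 4 15) M' ->
    square_prod (wt M) ^ 3 <= 15 ^ 39 * 96 ^ (k * n) * square_prod (wt M') ^ 3.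
Proof.
move=> n4 Mmax MD; have Mw := wt_is_weight Mmax.1.
have [X [k23 cutX]] := small_cut n4 Mmax MD; exists #|X| => // M' M'max.
have XC : #|~: X| = n - #|X| by have := cardsC X; rewrite card_ord; lia.
rewrite (square_prod_cut X Mw) 2!expnMn -expnM.
have inner : \prod_(x in X) \prod_(y in X) wt M x y <= 15 ^ 9.
  have le15 x y : wt M x y <= 15 by apply: weight_le15 => //; rewrite card_ord.
  apply: (@leq_trans (\prod_(x in X) \prod_(y in X) 15)).
    by apply: leq_prod => x _; apply: leq_prod.
  rewrite !prod_nat_const -expnM leq_pexp2l //.
  by case/andP: k23 => _ k3; apply: (leq_mul k3 k3).
have outer : \prod_(x in ~: X) \prod_(y in ~: X) wt M x y <= square_prod (wt M').
  (* Generalizing the size identifies the vertices of [M'] with the indices enumerating the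
     complement of [X]. *)
  move: XC; move: (n - #|X|) M' M'max => m M' M'max XC; subst m.
  rewrite big_enum_val /=; under eq_bigr => i _ do rewrite big_enum_val /=.
  apply: (maximizer_square_prod M'max
    (w := fun i j => wt M (enum_val i) (enum_val j))).
  by apply: is_weight_inj Mw; apply: enum_val_inj.
have inner3 := leq_exp2rW 3 inner; rewrite -(expnM 15) in inner3.
(* The exponent is 9 * 3 from the edges inside [X], plus 2 * 6 from the factor 225 ^ 6 of the
   cut. *)
have -> : 15 ^ 39 = 15 ^ (9 * 3) * 225 ^ 6.
  by rewrite -[225]/(15 ^ 2) -expnM -expnD.
move: inner3 cutX; move: (15 ^ (9 * 3)) (225 ^ 6) (96 ^ _) => p q r inner3 cutX.
apply: leq_trans (leq_mul (leq_mul (leq_exp2rW 3 outer) inner3) cutX) _.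
by rewrite -mulnA mulnC !mulnA.
Qed.

(** * Cloning vertices inside [D] *)

Lemma D_wt_le3 (n : nat) (G : multigraph 'I_n) (x y : 'I_n) :
  G \in D n -> wt G x y <= 3.
Proof.
rewrite !inE => /and3P[_ /max_mult_leP H _].
by have [->|/H//] := eqVneq x y; rewrite wtxx.
Qed.

(** Repetitions are allowed with cloning in view: they give at most 1 + 3 + 3 = 7. *)
Lemma D_wt_triple (n : nat) (G : multigraph 'I_n) (x y z : 'I_n) :
  G \in D n -> wt G x y + wt G x z + wt G y z <= 8.
Proof.
move=> GD; have le3 := D_wt_le3 _ _ GD; move: (le3 x y) (le3 x z) (le3 y z).
have [->|xy] := eqVneq x y; first by rewrite wtxx; lia.
have [->|xz] := eqVneq x z; first by rewrite wtxx (wtC G y); lia.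
have [->|yz] := eqVneq y z; first by rewrite wtxx; lia.
move: GD; rewrite !inE => /and3P[_ _ /sq_graph_3_8P H] *.
by apply: H; rewrite /= !inE negb_or xy xz yz.
Qed.

(* A repeated vertex [x = y] contributes [1 + 2 (w x z + w x t) + w z t], which is
   at most [1 + 6 + 8] by the bounds on edges and triples. *)
Lemma D_wt_quad (n : nat) (G : multigraph 'I_n) (x y z t : 'I_n) :
  G \in D n ->
  wt G x y + wt G x z + wt G x t + wt G y z + wt G y t + wt G z t <= 15.
Proof.
move=> GD; have le3 a b := D_wt_le3 a b GD; have tri a b c := D_wt_triple a b c GD.
have C := wtC G; have w1 := wtxx G.
have rep a b c : 1 + (wt G a b + wt G a c).*2 + wt G b c <= 15.
  by have := le3 a b; have := le3 a c; have := tri a b c; lia.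
have [?|xy] := eqVneq x y; first by subst; rewrite w1; have := rep y z t; lia.
have [?|xz] := eqVneq x z.
  by subst; rewrite w1 (C y); have := rep z y t; lia.
have [?|xt] := eqVneq x t.
  by subst; rewrite w1 (C y t) (C z t); have := rep t y z; lia.
have [?|yz] := eqVneq y z.
  by subst; rewrite w1 (C x z); have := rep z x t; lia.
have [?|yt] := eqVneq y t.
  by subst; rewrite w1 (C x t) (C z t); have := rep t x z; rewrite (C x z); lia.
have [?|zt] := eqVneq z t.
  by subst; rewrite w1 (C x t) (C y t); have := rep t x y; lia.
move: GD; rewrite !inE => /and3P[/sq_graph_4_15P H _ _].
by apply: H; rewrite /= !inE !negb_or xy xz xt yz yt zt.
Qed.

Lemma max_degree (m : nat) (w : 'I_m -> 'I_m -> nat) :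
  0 < m -> exists v, square_prod w <= (\prod_y w v y) ^ m.
Proof.
move=> m0; pose v := [arg max_(v > Ordinal m0) \prod_y w v y].
exists v; apply: (@leq_trans (\prod_(x : 'I_m) \prod_y w v y)).
  by apply: leq_prod => x _; rewrite /v; case: arg_maxnP => // i _; apply.
by rewrite prod_nat_const card_ord.
Qed.

(* Unlike [F n 4 15], the family [D n] is closed under cloning vertices. *)
Lemma maximizer_clone (m k : nat) (M : multigraph 'I_m) (M' : multigraph 'I_(m + k)) v :
  maximizes_prod (F m 4 15) M -> M \in D m ->
  maximizes_prod (F (m + k) 4 15) M' ->
  square_prod (wt M) * (\prod_y wt M v y) ^ (2 * k) <= square_prod (wt M').
Proof.
move=> Mmax MD M'max; pose f (i : 'I_(m + k)) := if split i is inl j then j else v.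
have fl j : f (lshift k j) = j by rewrite /f (unsplitK (inl j)).
have fr j : f (rshift m j) = v by rewrite /f (unsplitK (inr j)).
have ww : is_weight (fun i j => wt M (f i) (f j)).
  (* The map [f] is not injective, so the bound on quadruples is needed with repetitions. *)
  split=> [i j|i|x y z t _]; [exact: wtC | exact: wtxx | exact: D_wt_quad].
apply: leq_trans (maximizer_square_prod M'max ww).
have E : \prod_(i < m) (\prod_(j < m) wt M (f (lshift k i)) (f (lshift k j)) *
    \prod_(j < k) wt M (f (lshift k i)) (f (rshift m j))) =
    square_prod (wt M) * (\prod_y wt M v y) ^ k.
  rewrite big_split /=; congr (_ * _).
    by apply: eq_bigr => i _; apply: eq_bigr => j _; rewrite !fl.
  rewrite exchange_big /=.
  transitivity (\prod_(j < k) \prod_y wt M v y).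
    by apply: eq_bigr => j _; apply: eq_bigr => i _; rewrite fl fr wtC.
  by rewrite prod_nat_const card_ord.
have E' : \prod_(i < k) (\prod_(j < m) wt M (f (rshift m i)) (f (lshift k j)) *
    \prod_(j < k) wt M (f (rshift m i)) (f (rshift m j))) =
    (\prod_y wt M v y) ^ k.
  transitivity (\prod_(j < k) \prod_y wt M v y); last first.
    by rewrite prod_nat_const card_ord.
  apply: eq_bigr => i _.
  rewrite [X in _ * X]big1 ?muln1 => [|j _]; last by rewrite !fr wtxx.
  by apply: eq_bigr => j _; rewrite fl fr.
rewrite [leqRHS]/square_prod big_split_ord /=.
rewrite (eq_bigr _ (fun i _ => big_split_ord _ _ _)) /= E.
rewrite (eq_bigr _ (fun i _ => big_split_ord _ _ _)) /= E'.
by rewrite -mulnA -expnD mul2n addnn.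
Qed.

(** * Exponent arithmetic and the upper bound for maximizers outside [D] *)

(** This is Bernoulli's inequality (1 + 1/m) ^ n >= 1 + n/m, cleared of denominators. *)
Lemma expn_dominates (K m : nat) : exists n0, forall n, n0 <= n ->
  K * m ^ n < m.+1 ^ n.
Proof.
have bern n : m ^ n * (m + n) <= m * m.+1 ^ n.
  elim: n => [|n IH]; first by rewrite !expn0; lia.
  by move: IH; rewrite !expnS; nia.
exists (m * K).+1 => n Kn; have [->|m0] := posnP m.
  by rewrite exp0n ?muln0 ?exp1n //; lia.
rewrite -(ltn_pmul2l m0); apply: leq_trans (bern n).
rewrite mulnA (mulnC (m ^ n)) ltn_mul2r expn_gt0 m0 /=; lia.
Qed.

(** The exponents of [b] on the two sides differ by k(3 - k), which is nonnegative exactly because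
    [k <= 3]. *)
Lemma slow_step (a b p q k m : nat) :
  0 < a -> 0 < b -> 0 < k <= 3 ->
  p ^ 3 <= a * b ^ (k * (m + k)) * q ^ 3 ->
  q ^ 6 <= a ^ (2 * m) * b ^ (m * (m + 3)) ->
  p ^ 6 <= a ^ (2 * (m + k)) * b ^ ((m + k) * (m + k + 3)).
Proof.
move=> a0 b0 /andP[k0 k3] step slow; rewrite (expnM p 3 2).
apply: leq_trans (leq_exp2rW 2 step) _.
rewrite 2!expnMn -!expnM; apply: leq_trans (leq_mul (leqnn _) slow) _.
rewrite mulnACA -!expnD.
by apply: leq_mul; rewrite leq_pexp2l //; nia.
Qed.

(** Here [d] is the product at the cloned vertex. Cancelling [q ^ 3] between the deletion and
    cloning bounds leaves a bound on [d ^ (6 * k)]; its [m]-th power bounds [q ^ (6 * k)], and a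
    [k]-th root is taken. *)
Lemma slow_of_clone (a b d p q k m : nat) :
  0 < q -> 0 < a -> 0 < b -> 0 < k <= 3 ->
  p ^ 3 <= a * b ^ (k * (m + k)) * q ^ 3 ->
  q * d ^ (2 * k) <= p -> q <= d ^ m ->
  q ^ 6 <= a ^ (2 * m) * b ^ (m * (m + 3)).
Proof.
move=> q0 a0 b0 /andP[k0 k3] step clone deg.
have dk : d ^ (6 * k) <= a * b ^ (k * (m + k)).
  have := leq_trans (leq_exp2rW 3 clone) step.
  rewrite expnMn mulnC leq_pmul2r ?expn_gt0 ?q0 // -expnM.
  by have -> : 2 * k * 3 = 6 * k by lia.
rewrite -(leq_exp2r _ _ k0) -expnM.
apply: leq_trans (leq_exp2rW (6 * k) deg) _.
rewrite expnAC; apply: leq_trans (leq_exp2rW m dk) _.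
rewrite 2!expnMn -!expnM; apply: leq_mul; rewrite leq_pexp2l //; nia.
Qed.

(* Both constants come from [maximizer_step]; the exponent [n * (n + 3)] is chosen
   so that the bound propagates from [n - k] to [n] for all [k <= 3], see
   [slow_step]. *)
Definition slow (n : nat) (M : multigraph 'I_n) : Prop :=
  square_prod (wt M) ^ 6 <= (15 ^ 39) ^ (2 * n) * 96 ^ (n * (n + 3)).

Lemma maximizer_slow (n : nat) (M : multigraph 'I_n) :
  4 <= n -> maximizes_prod (F n 4 15) M -> M \notin D n -> slow M.
Proof.
elim/ltn_ind: n M => n IH M n4 Mmax MD.
have a0 : 0 < 15 ^ 39 by rewrite expn_gt0.
(* Below 7, deleting three vertices could leave fewer than 4; there the trivial bound by 15
   suffices, as 6 * n <= 78. *)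
have [n7|n7] := ltnP n 7.
  have le15 x y : wt M x y <= 15.
    by apply: weight_le15 (wt_is_weight Mmax.1); rewrite card_ord.
  have : square_prod (wt M) <= 15 ^ (n * n).
    apply: (@leq_trans (\prod_(x < n) \prod_(y < n) 15)).
      by apply: leq_prod => x _; apply: leq_prod.
    by rewrite !prod_nat_const !card_ord -expnM.
  move=> /(leq_exp2rW 6) /leq_trans; apply.
  apply: leq_trans (leq_pmulr _ _); last by rewrite expn_gt0.
  by rewrite -!expnM leq_pexp2l //; nia.
have [k /andP[k2 k3] step] := maximizer_step n4 Mmax MD.
have [m E] : exists m, n = m + k by exists (n - k); lia.
subst n; rewrite addnK in step.
have m4 : 4 <= m by lia.
have k0 : 0 < k by apply: leq_trans k2.
have [M' M'max] := maximizer_exists m4; have {}step := step M' M'max.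
have slowM' : slow M'.
  have [M'D|M'D] := boolP (M' \in D m); last by apply: IH => //; lia.
  have [v deg] : exists v, _ := max_degree (wt M') (ltn_trans (isT : 0 < 3) m4).
  have clone := maximizer_clone v M'max M'D Mmax.
  apply: (slow_of_clone _ a0 _ _ step clone deg) => //; last by rewrite k0.
  by do 2![apply: prodn_gt0 => ?]; apply: maximizer_wt_gt0.
by apply: (slow_step a0 _ _ step slowM') => //; rewrite k0.
Qed.

(** * The lower bound from a two-part construction *)

Definition split_weight (l n : nat) (i j : 'I_n) : nat :=
  if i == j then 1 else
  if i < l then (if j < l then 1 else 3) else (if j < l then 3 else 2).

(** Quadruples with 4, 3, 2, 1, 0 vertices in the first part have totals 6, 12, 15, 15, 12. *)
Lemma split_weight_is_weight (l n : nat) : is_weight (@split_weight l n).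
Proof.
split=> [i j|i|x y z t]; rewrite /split_weight.
- by rewrite eq_sym; case: eqP => // _; case: (i < l); case: (j < l).
- by rewrite eqxx.
rewrite /= !inE !negb_or andbT => /and3P[/and3P[xy xz xt] /andP[yz yt] zt].
rewrite (negPf xy) (negPf xz) (negPf xt) (negPf yz) (negPf yt) (negPf zt).
by case: (x < l); case: (y < l); case: (z < l); case: (t < l).
Qed.

(** The factor [2 ^ r] replaces the diagonal value 1 by 2 in the second part, making every block
    constant. *)
Lemma split_weight_prod (l r : nat) :
  square_prod (@split_weight l (l + r)) * 2 ^ r = 3 ^ (2 * l * r) * 2 ^ (r * r).
Proof.
pose c (i j : 'I_(l + r)) :=
  if i < l then (if j < l then 1 else 3) else (if j < l then 3 else 2).
have E : square_prod (@split_weight l (l + r)) * 2 ^ r = \prod_i \prod_j c i j.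
  transitivity (\prod_i ((\prod_j split_weight l i j) *
    (if (i : 'I_(l + r)) < l then 1 else 2))).
    rewrite big_split /=; congr (_ * _); rewrite big_split_ord /=.
    rewrite big1 ?mul1n => [|i _]; last by rewrite ltn_ord.
    rewrite (eq_bigr (fun _ => 2)) ?prod_nat_const ?card_ord // => i _.
    by rewrite ltnNge leq_addr.
  apply: eq_bigr => i _.
  rewrite (bigD1 i) //= [RHS](bigD1 i) //= {1}/split_weight eqxx mul1n mulnC.
  congr (_ * _); first by rewrite /c; case: ifP.
  by apply: eq_bigr => j; rewrite /split_weight eq_sym => /negPf->.
rewrite E big_split_ord /=.
have -> : \prod_(i < l) \prod_j c (lshift r i) j = (3 ^ r) ^ l.
  rewrite (eq_bigr (fun _ => 3 ^ r)) ?prod_nat_const ?card_ord // => i _.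
  rewrite big_split_ord /= big1 ?mul1n => [|j _]; last by rewrite /c /= !ltn_ord.
  rewrite (eq_bigr (fun _ => 3)) ?prod_nat_const ?card_ord // => j _.
  by rewrite /c /= ltn_ord ltnNge leq_addr.
have -> : \prod_(i < r) \prod_j c (rshift l i) j = (3 ^ l * 2 ^ r) ^ r.
  rewrite (eq_bigr (fun _ => 3 ^ l * 2 ^ r)) ?prod_nat_const ?card_ord // => i _.
  rewrite big_split_ord /=; congr (_ * _).
    rewrite (eq_bigr (fun _ => 3)) ?prod_nat_const ?card_ord // => j _.
    by rewrite /c /= ltn_ord ltnNge leq_addr.
  rewrite (eq_bigr (fun _ => 2)) ?prod_nat_const ?card_ord // => j _.
  by rewrite /c /= !ltnNge !leq_addr.
rewrite expnMn -!expnM mulnA -expnD; congr (3 ^ _ * _); lia.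
Qed.

(** For l = n/3 and r = 2n/3 both 2lr and r^2 equal 4n^2/9. The ninth power clears the denominator,
    and [6 ^ (9 * n)] absorbs rounding and the diagonal. *)
Lemma maximizer_lower_bound (n : nat) (M : multigraph 'I_n) :
  maximizes_prod (F n 4 15) M ->
  6 ^ (4 * (n * n)) <= square_prod (wt M) ^ 9 * 6 ^ (9 * n).
Proof.
have [l [r [E l3 r3]]] : exists l r, [/\ n = l + r, 3 * l <= n & n <= 3 * l + 2].
  by exists (n %/ 3), (n - n %/ 3); split; lia.
subst n => Mmax.
have := maximizer_square_prod Mmax (split_weight_is_weight l _).
rewrite -(leq_pmul2r (_ : 0 < 2 ^ r)) ?expn_gt0 // split_weight_prod.
move=> /(leq_exp2rW 9); rewrite 2!expnMn -!expnM => H.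
rewrite -(leq_pmul2r (_ : 0 < 2 ^ (r * 9))) ?expn_gt0 //.
rewrite mulnAC; apply: leq_trans (leq_mul H (leqnn _)).
rewrite -[6]/(3 * 2) !expnMn -mulnA mulnACA -!expnD.
by apply: leq_mul; rewrite leq_pexp2l //; nia.
Qed.

(** * Comparison of the two bounds and conclusion *)

(** Both bounds are raised to meet at [q ^ 18]; all remaining exponents are multiples of [n], so an
    [n]-th root can be taken. *)
Lemma combine_bounds (a s t n q K : nat) :
  0 < n -> K = a ^ 6 * t ^ 9 * s ^ 18 ->
  s ^ (4 * (n * n)) <= q ^ 9 * s ^ (9 * n) ->
  q ^ 6 <= a ^ (2 * n) * t ^ (n * (n + 3)) ->
  (s ^ 8) ^ n <= K * (t ^ 3) ^ n.
Proof.
move=> n0 -> lb sl; rewrite -(leq_exp2r _ _ n0).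
have {}lb := leq_exp2rW 2 lb; rewrite expnMn -!expnM in lb.
have {}sl := leq_exp2rW 3 sl; rewrite expnMn -!expnM in sl.
have H := leq_trans lb (leq_mul sl (leqnn _)).
have -> : ((s ^ 8) ^ n) ^ n = s ^ (4 * (n * n) * 2).
  by rewrite -!expnM; congr (s ^ _); lia.
apply: leq_trans H _; apply/eq_leq; rewrite 3!expnMn -!expnM.
have -> : 2 * n * 3 = 6 * n by lia.
have -> : 9 * n * 2 = 18 * n by lia.
have -> : n * (n + 3) * 3 = 9 * n + 3 * (n * n) by lia.
rewrite expnD; move: (a ^ _) (t ^ (9 * n)) (t ^ (3 * (n * n))) (s ^ _) => x y z u.
by rewrite mulnA mulnAC.
Qed.

(* The two bounds on [q] have leading terms [q ^ 18 >= 6 ^ (8 n ^ 2)] and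
   [q ^ 18 <= 96 ^ (3 n ^ 2)], and [6 ^ 8 / 96 ^ 3 = 3 ^ 5 / 2 ^ 7 > 1]. *)
Lemma slow_contradiction (a : nat) : exists n0, forall n q, n0 <= n ->
  6 ^ (4 * (n * n)) <= q ^ 9 * 6 ^ (9 * n) ->
  a ^ (2 * n) * 96 ^ (n * (n + 3)) < q ^ 6.
Proof.
have [K EK] : exists K, K = a ^ 6 * 96 ^ 9 * 6 ^ 18 by eexists.
have [n0 big] := expn_dominates K (2 ^ 7); exists n0.+1 => n q n0n lb.
rewrite ltnNge; apply/negP => sl.
(* Domination holds for base 2 ^ 7 + 1 = 129, below 3 ^ 5 = 243. *)
have {}big : K * (2 ^ 7) ^ n < (3 ^ 5) ^ n.
  by apply: leq_trans (big n (ltnW n0n)) (leq_exp2rW _ _).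
have := combine_bounds (leq_ltn_trans (leq0n _) n0n) EK lb sl.
apply/negP; rewrite -ltnNge.
have -> : 6 ^ 8 = 2 ^ 8 * 3 ^ 3 * 3 ^ 5.
  by rewrite -[6]/(2 * 3) expnMn -mulnA -expnD.
have -> : 96 ^ 3 = 2 ^ 8 * 3 ^ 3 * 2 ^ 7.
  by rewrite -[96]/(2 ^ 5 * 3) expnMn -expnM mulnAC -expnD.
have c0 : 0 < 2 ^ 8 * 3 ^ 3 by rewrite muln_gt0 !expn_gt0.
move: (2 ^ 8 * 3 ^ 3) c0 => c c0; rewrite !(expnMn c) mulnCA.
by rewrite ltn_pmul2l ?expn_gt0 ?c0.
Qed.

Lemma maximizer_in_D : exists n0, forall n (M : multigraph 'I_n),
  n0 <= n -> maximizes_prod (F n 4 15) M -> M \in D n.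
Proof.
have [n0 H] := slow_contradiction (15 ^ 39); exists (n0 + 4) => n M nn Mmax.
apply: contraT => MD.
have n4 : 4 <= n by lia.
have := maximizer_slow n4 Mmax MD; rewrite /slow leqNgt (H n) //; first by lia.
exact: maximizer_lower_bound.
Qed.

Theorem theorem4p2 :
  exists n0 : nat, forall n : nat, n0 <= n ->
    forall G : multigraph 'I_n,
      maximizes_prod (F n 4 15) G <-> maximizes_prod (D n) G.
Proof.
have [n0 inD] := maximizer_in_D; exists (n0 + 4) => n nn G.
have n0n : n0 <= n by lia.
have DF w : w \in D n -> w \in F n 4 15 by rewrite inE => /and3P[].
split=> [Gmax|[GD Gmax]].
  split; first exact: inD.
  by move=> w /DF; apply: Gmax.2.
(* The converse needs some maximizer over [F n 4 15]: it lies in [D n], so [G] does at least as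
   well. *)
have [M Mmax] : exists M, maximizes_prod (F n 4 15) M.
  by apply: maximizer_exists; lia.
split=> [|w wF]; first exact: DF.
exact: leq_trans (Mmax.2 w wF) (Gmax M (inD n M n0n Mmax)).
Qed.
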